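(* Let $K$ be a field, let $d<n$ be positive integers, and let $\Delta$ be a pure $d$-dimensional simplicial complex on $n$ vertices, labeled $1,\dots,n$. Then the determinantal facet ideal $J_\Delta$ has a linear resolution if and only if $\Delta=\Sigma^d_n$, where $\Sigma^d_n$ denotes the $d$-skeleton of the $(n-1)$-dimensional simplex (on the vertices $1,\dots,n$).
   Context: Let $S=K[x_{ij}: 0\le i\le d,\ 1\le j\le n]$ with the standard grading and let $X=(x_{ij})$ be the $(d+1)\times n$ matrix of variables (rows indexed $0,\dots,d$, columns indexed $1,\dots,n$). For $1\le b_0<\dots<b_d\le n$ let $[b_0\ldots b_d]$ be the maximal minor of $X$ on columns $b_0,\dots,b_d$. The determinantal facet ideal of $\Delta$ is $J_\Delta=([a_0\ldots a_d]: \{a_0<\dots<a_d\}\in\Delta)\subset S$, an ideal generated in degree $d+1$. *)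

(* Defs.v *)
(* MathComp world, with multinomials for polynomial rings. *)
From mathcomp Require Import all_boot all_order all_algebra.
From mathcomp Require Import mpoly.

Set Implicit Arguments.
Unset Strict Implicit.
Unset Printing Implicit Defensive.

Import GRing.Theory.
Local Open Scope ring_scope.

(* Vertices 1, ..., n are represented by the elements 0, ..., n-1 of 'I_n.
   All of them are required to be faces. *)
Definition simplicial_complex n (D : {set {set 'I_n}}) : Prop :=
  [/\ set0 \in D,
      forall i : 'I_n, [set i] \in D
    & forall F G : {set 'I_n}, F \in D -> G \subset F -> G \in D].

Definition facet n (D : {set {set 'I_n}}) (F : {set 'I_n}) : bool :=
  maxset (mem D) F.

(* A face with d + 1 vertices has dimension d. *)
Definition pure_dim n (d : nat) (D : {set {set 'I_n}}) : Prop :=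
  forall F : {set 'I_n}, facet D F -> #|F| = d.+1.

Definition simplex n : {set {set 'I_n}} := powerset [set: 'I_n].

Definition skeleton n (d : nat) (D : {set {set 'I_n}}) : {set {set 'I_n}} :=
  [set F in D | #|F| <= d.+1]%N.

Definition generated_ideal (R : comNzRingType) (G : R -> Prop) (p : R) : Prop :=
  exists k (c g : 'I_k -> R), (forall i, G (g i)) /\ p = \sum_i c i * g i.

(* The (d+1) x n variables x_ij are numbered by mxvec_index. *)
Definition generic_mx (K : fieldType) d n :
    'M[{mpoly K[d.+1 * n]}]_(d.+1, n) :=
  \matrix_(i, j) 'X_(mxvec_index i j).

Definition maximal_minor (K : fieldType) d n (b : 'I_d.+1 -> 'I_n) :
    {mpoly K[d.+1 * n]} :=
  \det (colsub b (generic_mx K d n)).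

Definition determinantal_facet_ideal (K : fieldType) d n
    (D : {set {set 'I_n}}) : {mpoly K[d.+1 * n]} -> Prop :=
  generated_ideal (fun g => exists b : 'I_d.+1 -> 'I_n,
    [/\ forall i j : 'I_d.+1, (i < j)%N -> (b i < b j)%N,
        [set b i | i : 'I_d.+1] \in D
      & g = maximal_minor K b]).
Arguments determinantal_facet_ideal K d {n} D _.

(* Graded free resolutions ... -> F_1 -> F_0 -> I -> 0 of an ideal I of
   S = K[x_0, ..., x_(N-1)], where F_i is the direct sum of the S(- a i r),
   r < b i.  Elements of F_i are row vectors, and the maps act by right
   multiplication by res_aug and res_map i.  The case split in res_map_homog
   is needed because S has no nonzero element of negative degree.  No bound is
   put on the length: F_i = 0 means b i = 0. *)
Record graded_free_resolution (K : fieldType) N (I : {mpoly K[N]} -> Prop) :=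
  GradedFreeResolution {
    res_rank : nat -> nat;
    res_shift : forall i, 'I_(res_rank i) -> nat;
    res_aug : 'cV[{mpoly K[N]}]_(res_rank 0);
    res_map : forall i, 'M[{mpoly K[N]}]_(res_rank i.+1, res_rank i);
    res_aug_homog : forall r, res_aug r 0 \is (res_shift r).-homog;
    res_map_homog : forall i (r : 'I_(res_rank i.+1)) (c : 'I_(res_rank i)),
      if (res_shift c <= res_shift r)%N
      then is_true (res_map i r c \is (res_shift r - res_shift c)%N.-homog)
      else res_map i r c = 0;
    res_aug_image : forall p,
      I p <-> exists v : 'rV_(res_rank 0), p = (v *m res_aug) 0 0;
    res_exact0 : forall v : 'rV_(res_rank 0),
      v *m res_aug = 0 <->
      exists w : 'rV_(res_rank 1), v = w *m res_map 0;
    res_exactS : forall i (v : 'rV_(res_rank i.+1)),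
      v *m res_map i = 0 <->
      exists w : 'rV_(res_rank i.+2), v = w *m res_map i.+1
  }.

(* All differentials F_(i+1) -> F_i have entries in (x_0, ..., x_(N-1)). *)
Definition minimal_resolution (K : fieldType) N (I : {mpoly K[N]} -> Prop)
    (F : graded_free_resolution I) : Prop :=
  forall i (r : 'I_(res_rank F i.+1)) (c : 'I_(res_rank F i)),
    (res_map F i r c)@_0%MM = 0.

(* F_i = S(-t-i)^(b i) for all i. *)
Definition linear_shifts (K : fieldType) N (I : {mpoly K[N]} -> Prop)
    (F : graded_free_resolution I) (t : nat) : Prop :=
  forall i (r : 'I_(res_rank F i)), res_shift r = (t + i)%N.

(* Minimal graded free resolutions are unique up to isomorphism, so that
   asking for one with linear shifts is asking it of all of them. *)
Definition has_linear_resolution (K : fieldType) N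
    (I : {mpoly K[N]} -> Prop) : Prop :=
  exists (t : nat) (F : graded_free_resolution I),
    minimal_resolution F /\ linear_shifts F t.

(* Main.v *)
(* If the resolution is linear, every syzygy of the minors [F], F a facet, is
   a combination of linear ones.  Specializing columns of X (to 0 or to each
   other) shows that a linear syzygy has a nonzero coefficient of x_ig at F
   only if all facets of the simplex F + g are in D; call F + g a clique then.
   Applied to the Koszul syzygy [G] e_F - [F] e_G this gives: for F <> G there
   is g in G \ F such that F + g is a clique.
   Taking G to contain a given vertex t and to meet F in as many vertices as
   possible, one sees that g can be any vertex outside F, so that D is
   complete.

   Conversely, the maximal minors [b] form an involutive basis: with V_b the
   set of the x_ic with b_(i-1) < c < b_i, their ideal is the direct sum of the
   K[x_v, v notin V_b] [b], and for v in V_b the product x_v [b] is rewritten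
   by a linear relation (a Laplace expansion with a repeated row) whose other
   terms have smaller weight.  As in Schreyer's theorem, these relations freely
   describe the syzygies: the relation s_(b,v) has the nonmultiplicative
   variables v' in V_b with v' < v, and the same two properties hold for the
   family s.  Iterating gives a resolution with linear maps. *)
Require Import Defs.
From HB Require Import structures.
From mathcomp Require Import all_boot all_order all_fingroup all_algebra.
From mathcomp Require Import mpoly zify.
From Stdlib Require Import ClassicalEpsilon.

Set Implicit Arguments.
Unset Strict Implicit.
Unset Printing Implicit Defensive.

Import GRing.Theory.
Local Open Scope ring_scope.

(** * Weighted degrees of monomials *)

Section Weights.
Variables (N : nat) (w : 'I_N -> nat).

Definition wdeg (m : 'X_{1..N}) : nat := (\sum_i m i * w i)%N.

Lemma wdegD m1 m2 : wdeg (m1 + m2)%MM = (wdeg m1 + wdeg m2)%N.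
Proof. by rewrite -big_split; apply: eq_bigr => i _; rewrite mnmDE mulnDl. Qed.

Lemma wdegU v : wdeg U_(v)%MM = w v.
Proof.
rewrite /wdeg (bigD1 v) //= big1 ?mnm1E ?eqxx ?mul1n ?addn0 // => i /negPf niv.
by rewrite mnm1E eq_sym niv.
Qed.

Lemma wdeg_sum (J : finType) (F : J -> 'X_{1..N}) :
  wdeg (\sum_j F j)%MM = (\sum_j wdeg (F j))%N.
Proof.
apply: (big_morph _ wdegD); rewrite /wdeg big1 // => i _.
by rewrite mnm0E.
Qed.
End Weights.

Lemma wdeg_scale N (w : 'I_N -> nat) k m :
  wdeg (fun v => k * w v)%N m = (k * wdeg w m)%N.
Proof. by rewrite /wdeg big_distrr; apply: eq_bigr => i _; rewrite mulnCA. Qed.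

(** * Row vectors with prescribed monomials in each position *)

Section Supports.
Variables (K : fieldType) (N r : nat).
Notation S := {mpoly K[N]}.
Implicit Types (T : 'X_{1..N} -> 'I_r -> bool) (c : 'rV[S]_r).

Definition supported T c : Prop :=
  forall j m, m \in msupp (c 0 j) -> T m j.

Lemma supported0 T : supported T 0.
Proof. by move=> j m; rewrite mxE msupp0. Qed.

Lemma supportedD T c1 c2 :
  supported T c1 -> supported T c2 -> supported T (c1 + c2).
Proof.
move=> h1 h2 j m; rewrite mxE => /msuppD_le; rewrite mem_cat => /orP[].
  exact: h1.
exact: h2.
Qed.

Lemma supportedN T c : supported T c -> supported T (- c).
Proof. by move=> h j m; rewrite mxE (perm_mem (msuppN _)); apply: h. Qed.

Lemma supportedB T c1 c2 :
  supported T c1 -> supported T c2 -> supported T (c1 - c2).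
Proof. by move=> h1 h2; apply/supportedD/supportedN. Qed.

Lemma supported_sum T (J : finType) (P : pred J) (F : J -> 'rV[S]_r) :
  (forall x, P x -> supported T (F x)) -> supported T (\sum_(x | P x) F x).
Proof.
move=> h; elim/big_ind: _ => //; first exact: supported0.
exact: supportedD.
Qed.

Lemma sub_supported T T' c :
  (forall m j, T m j -> T' m j) -> supported T c -> supported T' c.
Proof. by move=> h hc j m /hc /h. Qed.

Lemma supported_term T k m j :
  T m j -> supported T ((k *: 'X_[m] : S) *: delta_mx 0 j).
Proof.
move=> Tmj j' m'; rewrite !mxE eqxx /=; case: eqP => [->|_]; last first.
  by rewrite mulr0 msupp0.
by rewrite mulr1 => /msuppZ_le; rewrite msuppX inE => /eqP->.
Qed.

Lemma supported_mulX T k m c :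
  supported (fun m' j => T (m + m')%MM j) c ->
  supported T ((k *: 'X_[m] : S) *: c).
Proof.
move=> hc j m'; rewrite mxE -scalerAl mulrC => /msuppZ_le.
by rewrite (perm_mem (msuppMX _ _)) => /mapP[m'' /hc hm ->].
Qed.

Lemma supported_ind T (P : 'rV[S]_r -> Prop) :
    P 0 -> (forall c1 c2, P c1 -> P c2 -> P (c1 + c2)) ->
    (forall k m j, T m j -> P ((k *: 'X_[m]) *: delta_mx 0 j)) ->
  forall c, supported T c -> P c.
Proof.
move=> P0 PD PX c hc; rewrite [c]row_sum_delta.
elim/big_ind: _ => // j _; rewrite [c 0 j]mpolyE scaler_suml.
rewrite big_seq; elim/big_ind: _ => // m hm.
exact/PX/hc.
Qed.

End Supports.

(** * Involutive bases and the relations between their elements *)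

Section Involutive.
Variables (K : fieldType) (N : nat).
Notation S := {mpoly K[N]}.

Definition nonmult_free r (V : 'I_r -> {set 'I_N}) (m : 'X_{1..N}) (j : 'I_r) :=
  [forall v in V j, m v == 0%N].

(** [e j] is the weight of the [j]-th basis vector. The bound [B] makes rewriting terminate, while
    [P] tracks the ordinary degree, from which linearity is read off. *)
Definition lower r (w : 'I_N -> nat) (e : 'I_r -> nat) (P : pred nat) (B : nat)
    (m : 'X_{1..N}) (j : 'I_r) :=
  P (mdeg m) && (wdeg w m + e j < B)%N.

(* Every element of the row module of g is a unique sum of c_i g_i, where c_i
   does not involve the variables in V i.  The weights make the rewriting by
   the relations terminate. *)
Record involutive q r (g : 'M[S]_(r, q)) (V : 'I_r -> {set 'I_N})
    (w : 'I_N -> nat) (e : 'I_r -> nat) : Prop := Involutive {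
  involutive_inj : forall c : 'rV_r,
    supported (nonmult_free V) c -> c *m g = 0 -> c = 0;
  involutive_rel : forall i v, v \in V i -> exists2 s : 'rV_r, s *m g = 0 &
    supported (lower w e (pred1 1%N) (w v + e i)) (s - 'X_v *: delta_mx 0 i)
}.

(** Among the terms of [c] of top weight, each leading product [m + lm a] comes from a single index
    [a], and all other products are too light to cancel it. So the weight bound on [c] can be
    lowered down to zero. *)
Lemma leading_terms_inj q r (g : 'M[S]_(r, q)) (V : 'I_r -> {set 'I_N})
    (w : 'I_N -> nat) (e : 'I_q -> nat)
    (lm : 'I_r -> 'X_{1..N}) (li : 'I_r -> 'I_q) :
    (forall a m i, m \in msupp ((row a g - 'X_[lm a] *: delta_mx 0 (li a)) 0 i) ->
       (wdeg w m + e i < wdeg w (lm a) + e (li a))%N) ->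
    (forall a a' m m', nonmult_free V m a -> nonmult_free V m' a' ->
       li a = li a' -> (m + lm a = m' + lm a')%MM -> a = a') ->
  forall c : 'rV_r, supported (nonmult_free V) c -> c *m g = 0 -> c = 0.
Proof.
move=> hlow hinj c hc cg0.
pose wt (m : 'X_{1..N}) a := (wdeg w (m + lm a) + e (li a))%N.
pose bnd B := forall a m, m \in msupp (c 0 a) -> (wt m a < B)%N.
have [B0 hB0] : exists B, bnd B.
  exists (\max_a \max_(m <- msupp (c 0%R a)) (wt m a).+1)%N => a m hm.
  apply: leq_trans (leq_bigmax a).
  exact: (leq_bigmax_seq (F := fun m => (wt m a).+1)).
suff step B : bnd B.+1 -> bnd B.
  have: bnd 0%N by elim: B0 hB0 => // B IH /step.
  move=> h0; apply/rowP=> a; rewrite mxE; apply/eqP; rewrite -msupp_eq0.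
  by case: (msupp _) (h0 a) => // m s /(_ m (mem_head _ _)).
move=> hB a m hm; have := hB a m hm; rewrite ltnS leq_eqVlt => /orP[/eqP wm|//].
move/rowP/(_ (li a)): cg0; rewrite !mxE => /(congr1 (mcoeff (lm a + m)%MM)).
rewrite mcoeff0 raddf_sum /= (bigD1 a) //= big1 => [|a' na'].
  have -> : g a (li a) = 'X_[lm a] + (row a g - 'X_[lm a] *: delta_mx 0 (li a)) 0 (li a).
    by rewrite !mxE !eqxx /= mulr1 addrCA subrr addr0.
  rewrite addr0 mulrDr mcoeffD mcoeffMX [X in _ + X]memN_msupp_eq0 ?addr0; last first.
    apply/negP=> /msuppM_le /allpairsP[[m1 m2] /= [hm1 hm2 em]].
    have := hlow _ _ _ hm2; have := hB a m1 hm1.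
    have := congr1 (wdeg w) em; move: wm; rewrite /wt !wdegD; lia.
  by move/eqP; rewrite mcoeff_eq0 hm.
have -> : g a' (li a) = 'X_[lm a'] * (li a' == li a)%:R +
    (row a' g - 'X_[lm a'] *: delta_mx 0 (li a')) 0 (li a).
  by rewrite !mxE !eqxx /= [li a == _]eq_sym addrCA subrr addr0.
rewrite mulrDr mcoeffD [X in _ + X]memN_msupp_eq0 ?addr0; last first.
  apply/negP=> /msuppM_le /allpairsP[[m1 m2] /= [hm1 hm2 em]].
  have := hlow _ _ _ hm2; have := hB a' m1 hm1.
  have := congr1 (wdeg w) em; move: wm; rewrite /wt !wdegD; lia.
case: eqP => [eli|_]; last by rewrite mulr0 mulr0 mcoeff0.
rewrite mulr1; apply: memN_msupp_eq0; apply/negP.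
rewrite (perm_mem (msuppMX _ _)) => /mapP[m1 hm1 em].
case/eqP: na'; apply: (hinj _ _ m1 m) => //; try exact: hc.
by rewrite addmC -em addmC.
Qed.

(** * The relations as an involutive family of their own *)

Section Next.
Variables (q r : nat) (g : 'M[S]_(r, q)) (V : 'I_r -> {set 'I_N}).
Variables (w : 'I_N -> nat) (e : 'I_r -> nat).
Hypothesis hg : involutive g V w e.

Definition next_index : {set 'I_r * 'I_N} := [set iv | iv.2 \in V iv.1].
Notation r' := #|next_index|.
Definition next_nonmult (a : 'I_r') : {set 'I_N} :=
  [set v in V (enum_val a).1 | (v < (enum_val a).2)%N].
(* Compares first by w and e; ties are broken by the variable v, since the
   syzygy of x_v' s_(i,v) and x_v s_(i,v') has to lower the weight for v' < v. *)
Definition next_wt (v : 'I_N) : nat := (N.+1 * w v)%N.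
Definition next_shift (a : 'I_r') : nat :=
  (N.+1 * (w (enum_val a).2 + e (enum_val a).1) + (enum_val a).2)%N.

Lemma next_indexP i v : v \in V i -> exists a : 'I_r', enum_val a = (i, v).
Proof.
move=> hv; have h : (i, v) \in next_index by rewrite inE.
by exists (enum_rank_in h (i, v)); rewrite enum_rankK_in.
Qed.

Lemma next_val (a : 'I_r') : (enum_val a).2 \in V (enum_val a).1.
Proof. by have := enum_valP a; rewrite inE. Qed.

Definition lead_term (a : 'I_r') : 'rV[S]_r :=
  'X_(enum_val a).2 *: delta_mx 0 (enum_val a).1.

Definition relations (g' : 'M[S]_(r', r)) : Prop :=
  g' *m g = 0 /\ forall a, supported
    (lower w e (pred1 1%N) (w (enum_val a).2 + e (enum_val a).1)) (row a g' - lead_term a).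

Lemma relations_exist : exists g', relations g'.
Proof.
have h (a : 'I_r') : exists s : 'rV[S]_r, s *m g = 0 /\
    supported (lower w e (pred1 1%N) (w (enum_val a).2 + e (enum_val a).1)) (s - lead_term a).
  by have [s s0 hs] := involutive_rel hg (next_val a); exists s.
case: (fin_all_exists h) => f hf; exists (\matrix_a f a); split=> [|a].
  by apply/row_matrixP=> a; rewrite row_mul rowK row0; case: (hf a).
by rewrite rowK; case: (hf a).
Qed.

Section Relations.
Variable g' : 'M[S]_(r', r).
Hypothesis hg' : relations g'.

Lemma relations_lower a (m : 'X_{1..N}) i :
  m \in msupp ((row a g' - 'X_[U_((enum_val a).2)] *: delta_mx 0 (enum_val a).1) 0 i) ->
  (wdeg w m + e i < wdeg w U_((enum_val a).2) + e (enum_val a).1)%N.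
Proof. by move/(hg'.2 a) => /andP[_]; rewrite wdegU. Qed.

(** Division by the relations. A term divisible by a nonmultiplicative variable is a multiple of the
    leading term of a relation, and replacing it by the other terms lowers the weight. The support
    of [c'] is bounded through the leading terms replaced. *)
Lemma reduce P B (c : 'rV[S]_r) : supported (lower w e P B) c ->
  exists c0 c', [/\ c = c0 + c' *m g', supported (nonmult_free V) c0 &
    supported (fun m a => lower w e P B (m + U_((enum_val a).2))%MM
                                (enum_val a).1) c'].
Proof.
elim: B c => [|B IH] c hc.
  have -> : c = 0.
    apply/rowP=> j; rewrite mxE; apply/eqP; rewrite -msupp_eq0.
    case: (msupp _) (hc j) => // m s /(_ m (mem_head _ _)).
    by rewrite /lower ltn0 andbF.
  exists 0, 0; split; [by rewrite mul0mx addr0| |]; exact: supported0.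
have lowerS m j : lower w e P B m j -> lower w e P B.+1 m j.
  by rewrite /lower => /andP[-> h]; exact: leqW.
move: c hc; apply: supported_ind => [|c1 c2|k m j hm].
- exists 0, 0; split; [by rewrite mul0mx addr0| |]; exact: supported0.
- case=> [c10 [c1' [-> h10 h1']]] [c20 [c2' [-> h20 h2']]].
  exists (c10 + c20), (c1' + c2'); split; [|exact: supportedD..].
  by rewrite mulmxDl addrACA.
have [hfree|] := boolP (nonmult_free V m j).
  exists ((k *: 'X_[m]) *: delta_mx 0 j), 0; split; last exact: supported0.
    by rewrite mul0mx addr0.
  exact: supported_term.
rewrite negb_forall => /existsP[v0]; rewrite negb_imply => hv0.
case: (@arg_minnP _ v0 [pred v in V j | m v != 0%N] val hv0) => v /andP[vj mv] vmin.
have [a ea] := next_indexP vj.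
have mE : m = (m - U_(v) + U_(v))%MM by rewrite submK // lep1mP.
set m' := (m - U_(v))%MM in mE.
pose l := row a g' - lead_term a.
(* The other terms of the relation are linear and lighter than its leading term: multiplied by [m'],
   they keep the degree of [m] and have weight below [B]. *)
have hl : supported (lower w e P B) ((k *: 'X_[m']) *: l).
  apply: supported_mulX; apply: sub_supported (hg'.2 a) => m1 i.
  move: hm; rewrite /lower ea /= {1 2}mE !mdegD !wdegD mdeg1 wdegU.
  by move=> /andP[h0 h1] /andP[/eqP-> h2]; rewrite h0 /=; lia.
have [c0 [c' [ec h0 h']]] := IH _ hl.
exists (- c0), ((k *: 'X_[m']) *: delta_mx 0 a - c'); split.
- rewrite mulmxBl -scalemxAl -rowE addrCA -opprD -ec -scalerBr /l opprB addrC subrK.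
  by rewrite /lead_term ea /= {1}mE mpolyXD scalerA scalerAl.
- exact: supportedN.
- apply: supportedB; last by apply: sub_supported h' => *; exact: lowerS.
  by apply: supported_term; rewrite ea /= -mE.
Qed.

Lemma lower_bound (c : 'rV[S]_r) : exists B, supported (lower w e predT B) c.
Proof.
exists (\max_j \max_(m <- msupp (c 0%R j)) (wdeg w m + e j).+1)%N => j m hm.
rewrite /lower /=; apply: leq_trans (leq_bigmax j).
exact: (leq_bigmax_seq (F := fun m => (wdeg w m + e j).+1)).
Qed.

(** The remainder of the division is again killed by [g], so it is zero by injectivity. *)
Lemma kernel_reduce P B (c : 'rV[S]_r) :
    c *m g = 0 -> supported (lower w e P B) c ->
  exists2 c', c = c' *m g' &
    supported (fun m a => lower w e P B (m + U_((enum_val a).2))%MM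
                                (enum_val a).1) c'.
Proof.
move=> cg0 /reduce[c0 [c' [ec h0 h']]]; exists c' => //.
have c00 : c0 *m g = 0.
  by move: cg0; rewrite ec mulmxDl -mulmxA hg'.1 mulmx0 addr0.
by rewrite ec (involutive_inj hg h0 c00) add0r.
Qed.

Lemma relations_exact (c : 'rV[S]_r) : c *m g = 0 <-> exists c', c = c' *m g'.
Proof.
split=> [cg0|[c' ->]]; last by rewrite -mulmxA hg'.1 mulmx0.
have [B /(kernel_reduce cg0)[c' ec _]] := lower_bound c.
by exists c'.
Qed.

Lemma relations_homog a i : g' a i \is 1.-homog.
Proof.
have -> : g' a i = 'X_(enum_val a).2 * ((enum_val a).1 == i)%:R
                   + (row a g' - lead_term a) 0 i.
  by rewrite !mxE eqxx /= [i == _]eq_sym addrCA subrr addr0.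
apply: dhomogD.
  by case: (_ == _); rewrite ?mulr1 ?mulr0 ?dhomog0 // dhomogX /= mdeg1.
by apply/dhomogP=> m /(hg'.2 a) /andP[/eqP].
Qed.

(** Injectivity: if multiples of two leading terms at the same position agree, the smaller variable
    divides the multiplier of the other relation, for which it is nonmultiplicative. Relations: for
    [v' < v], reduce the S-polynomial of the relations for [v] and [v']. *)
Lemma involutive_next : involutive g' next_nonmult next_wt next_shift.
Proof.
split=> [|a v'].
  apply: leading_terms_inj relations_lower _ => a a' m m' hm hm' ei em.
  suff ev : (enum_val a).2 = (enum_val a').2.
    by apply: enum_val_inj; rewrite [LHS]surjective_pairing ei ev -surjective_pairing.
  have lt_contra (b b' : 'I_r') m1 m1' : nonmult_free next_nonmult m1' b' ->
      (enum_val b).1 = (enum_val b').1 ->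
      (m1 + U_((enum_val b).2) = m1' + U_((enum_val b').2))%MM ->
      ~~ ((enum_val b).2 < (enum_val b').2)%N.
    move=> /forallP/(_ (enum_val b).2) h eb /(congr1 (fun m : 'X_{1..N} => m (enum_val b).2)).
    rewrite !mnmDE !mnm1E eqxx => eb1; apply/negP=> lt_b.
    move: h eb1; rewrite inE -eb next_val lt_b /= => /eqP->.
    by case: eqP lt_b => [->|_ _]; [rewrite ltnn | rewrite addn1].
  apply/val_inj/eqP; rewrite eqn_leq.
  by rewrite leqNgt (lt_contra _ _ _ _ hm (esym ei) (esym em)) leqNgt (lt_contra _ _ _ _ hm' ei em).
rewrite inE => /andP[v'V lt_v'].
have [a' ea'] := next_indexP v'V.
set i := (enum_val a).1 in v'V ea'; set v := (enum_val a).2 in lt_v'.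
(* Both products have the leading term x_v x_v' at position [i]. These cancel, so [y] can be written
   with the lower terms only. *)
pose y := 'X_v' *: (row a g' - lead_term a) - 'X_v *: (row a' g' - lead_term a').
have yE : y = 'X_v' *: row a g' - 'X_v *: row a' g'.
  rewrite /y !scalerBr /lead_term ea' /= !scalerA [in X in _ - (_ - X)]mulrC.
  by rewrite opprB addrA subrK.
have y0 : y *m g = 0.
  by rewrite yE mulmxBl -!scalemxAl -!row_mul hg'.1 !row0 !scaler0 subrr.
have hy : supported (lower w e (pred1 2%N) (w v + w v' + e i)%N) y.
  rewrite /y -['X_v']scale1r -['X_v]scale1r; apply: supportedB; apply: supported_mulX.
    apply: sub_supported (hg'.2 a) => m j /andP[/eqP h1 h2].
    by rewrite /lower mdegD wdegD mdeg1 wdegU h1 /=; rewrite -/i -/v in h2; lia.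
  apply: sub_supported (hg'.2 a') => m j /andP[/eqP h1 h2].
  by rewrite /lower mdegD wdegD mdeg1 wdegU h1 /=; rewrite ea' /= in h2; lia.
have [c' ec h'] := kernel_reduce y0 hy.
exists ('X_v' *: delta_mx 0 a - 'X_v *: delta_mx 0 a' - c').
  by rewrite !mulmxBl -!scalemxAl -!rowE -yE ec subrr.
rewrite [X in supported _ X]addrAC [X in X - c']addrAC subrr add0r -opprD; apply: supportedN; apply: supportedD.
  rewrite -['X_v]scale1r; apply: supported_term.
  rewrite /lower mdeg1 wdegU /next_wt /next_shift ea' -/i -/v /=.
  by rewrite !mulnDr; lia.
(* Degree 2 is 1 for the leading variable plus 1 for the coefficient, so the new relation is
   linear. *)
apply: sub_supported h' => m a2; rewrite /lower mdegD mdeg1 wdegD wdegU addn1.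
move=> /andP[/eqP[->] h2]; rewrite /= wdeg_scale /next_wt /next_shift -/i -/v.
set x := (enum_val a2).2 in h2 *.
(* Scaled by [N.+1], the strict inequality [h2] leaves a gap larger than the tie-breaking index
   [x]. *)
have : (x < N.+1)%N by rewrite ltnS ltnW.
move: h2; move: (N.+1) (wdeg w m) (w x) (e _) (nat_of_ord x) => M A1 A2 A3 z hA hz.
have : (M * (A1 + A2 + A3).+1 <= M * (w v + w v' + e i))%N by rewrite leq_mul2l hA orbT.
by rewrite mulnS !mulnDr; lia.
Qed.
End Relations.
End Next.
End Involutive.

(** * Iterated relations as a linear resolution *)

Section Resolution.
Variables (K : fieldType) (N : nat).
Notation S := {mpoly K[N]}.

(** The matrix is bundled with its sizes, which change from step to step, so that the construction
    can be iterated. *)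
Record involutive_family := InvolutiveFamily {
  inv_cols : nat;
  inv_rows : nat;
  inv_mx : 'M[S]_(inv_rows, inv_cols);
  inv_nonmult : 'I_inv_rows -> {set 'I_N};
  inv_wt : 'I_N -> nat;
  inv_shift : 'I_inv_rows -> nat;
  inv_ok : involutive inv_mx inv_nonmult inv_wt inv_shift
}.

Definition chosen_relations (x : involutive_family) :=
  constructive_indefinite_description _ (relations_exist (inv_ok x)).

Definition next_family (x : involutive_family) : involutive_family :=
  InvolutiveFamily (involutive_next (inv_ok x) (proj2_sig (chosen_relations x))).

(** Each stage is exact by [relations_exact]. The later matrices have linear entries, hence no
    constant terms, which gives minimality. *)
Lemma linear_resolution_of_involutive (I : S -> Prop) t r (g : 'cV[S]_r) V w e :
    involutive g V w e -> (forall i, g i 0 \is t.-homog) ->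
    (forall p, I p <-> exists v : 'rV_r, p = (v *m g) 0 0) ->
  has_linear_resolution I.
Proof.
move=> hg homog_g image_g.
pose x k := iter k next_family (InvolutiveFamily hg).
have homog1 k a i : inv_mx (x k.+1) a i \is 1.-homog.
  exact: (relations_homog (proj2_sig (chosen_relations (x k)))).
(* The number of columns of the next matrix is the number of rows of this one only up to conversion,
   hence the ascription. *)
have exactS k (v : 'rV_(inv_rows (x k))) : v *m inv_mx (x k) = 0 <->
    exists w', v = w' *m (inv_mx (x k.+1) : 'M_(_, inv_rows (x k))).
  exact: (relations_exact (inv_ok (x k)) (proj2_sig (chosen_relations (x k)))).
have homogS i (a : 'I_(inv_rows (x i.+1))) (c : 'I_(inv_rows (x i))) :
    if (t + i <= t + i.+1)%N
    then is_true ((inv_mx (x i.+1) : 'M_(_, inv_rows (x i))) a c \is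
                    (t + i.+1 - (t + i))%N.-homog)
    else (inv_mx (x i.+1) : 'M_(_, inv_rows (x i))) a c = 0.
  by rewrite leq_add2l leqnSn subnDl subSnn; apply: homog1.
have homog0 (a : 'I_(inv_rows (x 0))) : g a 0 \is (t + 0)%N.-homog.
  by rewrite addn0.
pose F := @GradedFreeResolution K N I (fun k => inv_rows (x k))
  (fun k _ => (t + k)%N) g (fun k => inv_mx (x k.+1)) homog0 homogS image_g
  (exactS 0) (fun k => exactS k.+1).
exists t, F; split=> // i a c.
by apply: (dhomog_nemf_coeff (homog1 i a c)); rewrite /= mdeg0.
Qed.
End Resolution.

(** * Inequalities for the weights *)

Lemma rearrangement_lt p (f : 'I_p -> nat) (s : 'S_p) :
    (forall i j : 'I_p, (i < j)%N -> (f i < f j)%N) -> s != 1%g ->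
  (\sum_(i < p) i * f (s i) < \sum_(i < p) i * f i)%N.
Proof.
move=> f_incr.
pose W (s : 'S_p) := (\sum_(i < p) i * f (s i))%N.
(* Removing an inversion increases W, so that its maximum is at 1. *)
have improve (s1 : 'S_p) : s1 != 1%g -> exists s2, (W s1 < W s2)%N.
  move=> s1_neq.
  have [i [j [ltij lts]]] : exists i j : 'I_p, (i < j)%N /\ (s1 j < s1 i)%N.
    have /existsP[i0 hi0] : [exists i, s1 i != i].
      rewrite -negb_forall; apply: contra s1_neq => /forallP h.
      by apply/eqP/permP=> i; rewrite perm1; apply/eqP.
    (* At the first moved point [i], both its image and its preimage exceed [i], which gives an
       inversion. *)
    case: (@arg_minnP _ i0 [pred i | s1 i != i] val hi0) => i /= si_neq imin.
    have fix_lt (k : 'I_p) : (k < i)%N -> s1 k = k.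
      by move=> ltki; apply/eqP/negPn/negP=> /imin; rewrite leqNgt ltki.
    exists i, ((s1^-1)%g i); rewrite permKV.
    have gt_si : (i < s1 i)%N.
      rewrite ltnNge leq_eqVlt negb_or si_neq /=; apply/negP=> /fix_lt /perm_inj.
      by apply/eqP.
    split=> //; rewrite ltn_neqAle; apply/andP; split.
      by apply: contraNneq si_neq => /val_inj {1}->; rewrite permKV.
    by rewrite leqNgt; apply/negP=> /fix_lt; rewrite permKV => ei; rewrite {1}ei permKV eqxx in si_neq.
  exists (tperm i j * s1)%g; rewrite /W.
  have nij : j != i by apply: contraTneq ltij => ->; rewrite ltnn.
  rewrite (bigD1 i) // (bigD1 j) //= [X in (_ < X)%N](bigD1 i) // [X in (_ < _ + X)%N](bigD1 j) //=.
  rewrite !permM tpermL tpermR.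
  rewrite [X in (_ < _ + (_ + X))%N](eq_bigr (fun k : 'I_p => k * f (s1 k))%N); last first.
    by move=> k /andP[nki nkj]; rewrite permM tpermD // eq_sym.
  have := f_incr _ _ lts; rewrite !addnA ltn_add2r.
  by move: ltij (f _) (f _) => ltij f1 f2 ltf; nia.
case: (@arg_maxnP _ (1%g : 'S_p) xpredT W isT) => s0 _ s0max.
have s01 : s0 = 1%g.
  apply/eqP/negPn/negP=> /improve[s2]; rewrite ltnNge => /negP[]; exact: s0max.
have W1 : W 1%g = (\sum_(i < p) i * f i)%N by apply: eq_bigr => i _; rewrite perm1.
move=> /improve[s2 lt2]; rewrite -/(W s) -W1 -s01.
exact: leq_trans lt2 (s0max _ isT).
Qed.

(* As a function of k, the left-hand side increases up to k = i and decreases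
   afterwards. *)
Lemma relation_weight_lt p (u : 'I_p.+1 -> nat) (i k : 'I_p.+1) :
    (forall j l : 'I_p.+1, (j < l)%N -> (u j < u l)%N) -> k != i ->
  (\sum_(j < p) (2 * j).+1 * u (lift k j) + 2 * i * u k <
   \sum_(j < p) (2 * j).+1 * u (lift i j) + 2 * i * u i)%N.
Proof.
move=> u_incr nki.
pose v m := u (inord m).
pose F m := (\sum_(j < p) (2 * j).+1 * v (bump m j) + 2 * i * v m)%N.
have FE (m : 'I_p.+1) : (\sum_(j < p) (2 * j).+1 * u (lift m j) + 2 * i * u m = F m)%N.
  rewrite /F /v inord_val; congr (_ + _)%N; apply: eq_bigr => j _.
  by congr (_ * u _)%N; apply: val_inj; rewrite /= inordK // ltnS -ltnS (ltn_ord (lift m j)).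
have v_incr m : (m < p)%N -> (v m < v m.+1)%N.
  by move=> ltmp; apply: u_incr; rewrite !inordK // ltnS // ltnW.
(* Only the summand [j = m] and the last term change: F(m+1) - F(m) = (2i - 2m - 1)(v(m+1) - v(m)),
   which is positive exactly for [m < i]. *)
have stepF m : (m < p)%N ->
    (F m.+1 + 2 * i * v m + (2 * m).+1 * v m.+1 =
     F m + 2 * i * v m.+1 + (2 * m).+1 * v m)%N.
  move=> ltmp; pose j0 := Ordinal ltmp.
  rewrite /F (bigD1 j0) //= [X in _ = (X + _ + _ + _)%N](bigD1 j0) //=.
  rewrite (eq_bigr (fun j : 'I_p => (2 * j).+1 * v (bump m j)))%N; last first.
    move=> j nj; rewrite /bump; case: (ltngtP m j) => // ej.
    by case/eqP: nj; apply: val_inj.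
  rewrite /bump ltnn leqnn add0n add1n.
  by lia.
rewrite !FE {FE}; case: (ltngtP k i) => [ltki|ltik|/val_inj ek]; last by rewrite ek eqxx in nki.
  have up m : (m < i)%N -> (F m < F m.+1)%N.
    move=> ltmi; have ltmp : (m < p)%N by have := ltn_ord i; lia.
    have := stepF _ ltmp; have := v_incr _ ltmp.
    by move: (F _) (F _) (v _) (v _) => F1 F2 v1 v2; nia.
  have le_up m : (k < m <= i)%N -> (F k < F m)%N.
    elim: m => // m IH /andP[]; rewrite ltnS leq_eqVlt => /orP[/eqP<- /up //|ltkm lemi].
    by apply: ltn_trans (up _ lemi); apply: IH; rewrite ltkm ltnW.
  by apply: le_up; rewrite ltki leqnn.
have down m : (i <= m < k)%N -> (F m.+1 < F m)%N.
  move=> /andP[leim ltmk]; have ltmp : (m < p)%N by have := ltn_ord k; lia.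
  have := stepF _ ltmp; have := v_incr _ ltmp.
  by move: (F _) (F _) (v _) (v _) => F1 F2 v1 v2; nia.
have lt_down m : (i < m <= k)%N -> (F m < F i)%N.
  elim: m => // m IH /andP[]; rewrite ltnS leq_eqVlt => /orP[/eqP<- ltmk|ltim lemk].
    by apply: down; rewrite leqnn.
  by apply: ltn_trans (IH _); [apply: down; rewrite ltnW | rewrite ltim ltnW].
by apply: lt_down; rewrite ltik leqnn.
Qed.

(** * The generic matrix, its maximal minors and their Laplace relations *)

Lemma mxvec_index_eq m n (i i' : 'I_m) (j j' : 'I_n) :
  (mxvec_index i j == mxvec_index i' j') = (i == i') && (j == j').
Proof. by rewrite (inj_eq (@cast_ord_inj _ _ _)) (inj_eq enum_rank_inj) xpair_eqE. Qed.

Section Minors.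
Variables (K : fieldType) (d n : nat).
Notation N := (d.+1 * n)%N.
Notation S := {mpoly K[N]}.
Notation X := (generic_mx K d n).

Definition increasing p (b : 'I_p -> 'I_n) :=
  [forall i : 'I_p, forall j : 'I_p, (i < j)%N ==> (b i < b j)%N].

Lemma increasingP p (b : 'I_p -> 'I_n) :
  reflect (forall i j : 'I_p, (i < j)%N -> (b i < b j)%N) (increasing b).
Proof.
by apply: (iffP 'forall_'forall_implyP) => h i j; apply: h.
Qed.

Lemma eq_maximal_minor (b b' : 'I_d.+1 -> 'I_n) :
  b =1 b' -> maximal_minor K b = maximal_minor K b'.
Proof. by move=> eb; congr (\det _); apply/matrixP=> i j; rewrite !mxE eb. Qed.

Definition minor_indices (D : {set {set 'I_n}}) : {set {ffun 'I_d.+1 -> 'I_n}} :=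
  [set b : {ffun 'I_d.+1 -> 'I_n} | increasing b && ([set b i | i : 'I_d.+1] \in D)].

Definition minors (D : {set {set 'I_n}}) : 'cV[S]_#|minor_indices D| :=
  \col_(a < #|minor_indices D|) maximal_minor K (enum_val a).

Lemma minor_indexP (D : {set {set 'I_n}}) (b : 'I_d.+1 -> 'I_n) :
    increasing b -> [set b i | i : 'I_d.+1] \in D ->
  exists a : 'I_#|minor_indices D|, enum_val a =1 b.
Proof.
move=> b_incr bD; have h : [ffun i => b i] \in minor_indices D.
  rewrite inE; apply/andP; split.
    by apply/increasingP=> i j; rewrite !ffunE; apply/increasingP.
  by rewrite (eq_imset _ (g := b)) // => i; rewrite ffunE.
by exists (enum_rank_in h [ffun i => b i]) => i; rewrite enum_rankK_in ?ffunE.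
Qed.

Lemma minor_index_incr (D : {set {set 'I_n}}) (a : 'I_#|minor_indices D|) : increasing (enum_val a).
Proof. by have := enum_valP a; rewrite inE => /andP[]. Qed.

Lemma determinantal_facet_idealE (D : {set {set 'I_n}}) p :
  determinantal_facet_ideal K d D p <->
  exists v : 'rV_#|minor_indices D|, p = (v *m minors D) 0 0.
Proof.
split=> [[k [c [g [hg ->]]]]|[v ->]].
  elim/big_ind: _ => [|p1 p2 [v1 ->] [v2 ->]|i _].
  - by exists 0; rewrite mul0mx mxE.
  - by exists (v1 + v2); rewrite mulmxDl [RHS]mxE.
  have [b [/increasingP b_incr bD ->]] := hg i.
  have [a ea] := minor_indexP b_incr bD.
  exists (c i *: delta_mx 0 a).
  by rewrite -scalemxAl -rowE !mxE (eq_maximal_minor ea).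
exists #|minor_indices D|, (v 0), (fun a => minors D a 0); split; last by rewrite mxE.
move=> a; exists (enum_val a); rewrite mxE.
by have := enum_valP a; rewrite inE => /andP[/increasingP].
Qed.

Lemma maximal_minorE (b : 'I_d.+1 -> 'I_n) : maximal_minor K b =
  \sum_(s : 'S_d.+1) ((-1) ^+ s : K) *: 'X_[\sum_i U_(mxvec_index i (b (s i)))].
Proof.
rewrite /maximal_minor /determinant; apply: eq_bigr => s _.
rewrite -mprodXE -mul_mpolyC rmorphXn rmorphN1; congr (_ * _).
by apply: eq_bigr => i _; rewrite !mxE.
Qed.

Lemma maximal_minor_homog (b : 'I_d.+1 -> 'I_n) :
  maximal_minor K b \is d.+1.-homog.
Proof.
rewrite maximal_minorE; apply: rpred_sum => s _; apply: rpredZ.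
rewrite dhomogX /= mdeg_sum -[X in _ == X]card_ord -sum1_card.
by apply/eqP/eq_bigr => i _; rewrite mdeg1.
Qed.

(* Laplace expansion, along its first row, of the minor of X on the columns u
   with row i repeated on top. *)
Lemma minor_relation (u : 'I_d.+2 -> 'I_n) (i : 'I_d.+1) :
  \sum_(k < d.+2) ((-1) ^+ k : K) *:
    ('X_(mxvec_index i (u k)) * maximal_minor K (fun j : 'I_d.+1 => u (lift k j))) = 0.
Proof.
pose A : 'M[S]_d.+2 := \matrix_(a, k) X (if unlift ord0 a is Some j then j else i) (u k).
have : \det A = 0.
  apply: (determinant_alternate (i1 := ord0) (i2 := lift ord0 i)) => // k.
  by rewrite !mxE unlift_none liftK.
rewrite (expand_det_row A ord0) => A0; rewrite -[RHS]A0.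
apply: eq_bigr => k _; rewrite /cofactor add0n !mxE unlift_none mulrCA.
rewrite -mul_mpolyC rmorphXn rmorphN1; congr (_ * (_ * \det _)).
by apply/matrixP=> a j; rewrite !mxE liftK.
Qed.

End Minors.

(** * The maximal minors as an involutive basis *)

Section MaximalMinors.
Variables (K : fieldType) (d n : nat).
Notation N := (d.+1 * n)%N.
Notation S := {mpoly K[N]}.
Variable D : {set {set 'I_n}}.
Hypothesis D_full : forall b : 'I_d.+1 -> 'I_n,
  increasing b -> [set b i | i : 'I_d.+1] \in D.
Notation B := (minor_indices d D).

(* The variables x_ic with b_(i-1) < c < b_i. *)
Definition minor_nonmult (a : 'I_#|B|) : {set 'I_N} :=
  [set mxvec_index ic.1 ic.2 | ic : 'I_d.+1 * 'I_n &
    (ic.2 < enum_val a ic.1)%N &&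
    [forall j : 'I_d.+1, (j < ic.1)%N ==> (enum_val a j < ic.2)%N]].
(* For these weights the leading term of a minor is its diagonal term. *)
Definition minor_wt (v : 'I_N) : nat :=
  mxvec (\matrix_(i < d.+1, j < n) (2 * i * j)%N) 0 v.
(** The odd factors interleave with the even factors [2 * i] of [minor_wt]. This makes one term of
    each Laplace relation strictly the heaviest, by [relation_weight_lt]. *)
Definition minor_shift (a : 'I_#|B|) : nat :=
  (\sum_(j < d.+1) (2 * j).+1 * enum_val a j)%N.
Definition diag_monomial (a : 'I_#|B|) : 'X_{1..N} :=
  (\sum_(i < d.+1) U_(mxvec_index i (enum_val a i)))%MM.

Lemma minor_wtE i c : minor_wt (mxvec_index i c) = (2 * i * c)%N.
Proof. by rewrite /minor_wt mxvecE mxE. Qed.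

Lemma diag_monomialE a i c :
  diag_monomial a (mxvec_index i c) = (enum_val a i == c).
Proof.
rewrite mnm_sumE (bigD1 i) //= big1 ?addn0 => [|j nj]; rewrite mnm1E.
  by rewrite mxvec_index_eq eqxx.
by rewrite mxvec_index_eq (negPf nj).
Qed.

(** Injectivity uses the diagonal leading terms, with zero shifts. The relations come from inserting
    the column of a nonmultiplicative variable into the index sequence and applying
    [minor_relation]. *)
Lemma minors_involutive :
  involutive (minors K d D) minor_nonmult minor_wt minor_shift.
Proof.
split.
  apply: (leading_terms_inj (w := minor_wt) (e := fun _ => 0%N)
            (lm := diag_monomial) (li := fun _ => 0)).
    move=> a m i; rewrite ord1 !mxE eqxx mulr1 !addn0 maximal_minorE (bigD1 1%g) //=.
    have -> : (\sum_i U_(mxvec_index i (enum_val a ((1%g : 'S_d.+1) i))))%MM = diag_monomial a.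
      by apply: eq_bigr => j _; rewrite perm1.
    rewrite odd_perm1 expr0 scale1r addrC addrA addNr add0r.
    move=> /msupp_sum_le /flatten_mapP[s].
    rewrite mem_filter => /andP[ns _] /msuppZ_le; rewrite msuppX inE => /eqP->.
    rewrite !wdeg_sum.
    under eq_bigr do rewrite wdegU minor_wtE -mulnA.
    under [X in (_ < X)%N]eq_bigr do rewrite wdegU minor_wtE -mulnA.
    rewrite -!big_distrr ltn_pmul2l //=.
    apply: (rearrangement_lt (f := fun j => enum_val a j : nat)) => //.
    exact/increasingP/minor_index_incr.
  move=> a a' m m' hm hm' _ em.
  (* Were the entry of [a2] at [i] smaller, its variable in row [i] would be nonmultiplicative for
     [a1] and absent from [diag_monomial a1], yet divide the right-hand side. *)
  have key (a1 a2 : 'I_#|B|) m1 m2 (i : 'I_d.+1) : nonmult_free minor_nonmult m1 a1 ->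
      (m1 + diag_monomial a1 = m2 + diag_monomial a2)%MM ->
      (forall j : 'I_d.+1, (j < i)%N -> enum_val a1 j = enum_val a2 j) ->
      (enum_val a1 i <= enum_val a2 i)%N.
    move=> /forallP/(_ (mxvec_index i (enum_val a2 i))) h.
    move=> /(congr1 (fun m : 'X_{1..N} => m (mxvec_index i (enum_val a2 i)))).
    rewrite !mnmDE !diag_monomialE eqxx => em1 eq_lt.
    rewrite leqNgt; apply/negP=> lt21; move: h em1.
    have -> : mxvec_index i (enum_val a2 i) \in minor_nonmult a1.
      apply/imsetP; exists (i, enum_val a2 i) => //.
      rewrite inE /= lt21; apply/forall_inP=> j ltji; rewrite eq_lt //.
      by move/increasingP: (minor_index_incr a2); apply.
    move=> /eqP->; case: eqP lt21 => [->|_ _]; first by rewrite ltnn.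
    by rewrite addn1.
  have eq_b k : forall i : 'I_d.+1, (i < k)%N -> enum_val a i = enum_val a' i.
    elim: k => // k IH i; rewrite ltnS leq_eqVlt => /orP[/eqP ei|/IH //].
    have eq_lt (j : 'I_d.+1) : (j < i)%N -> enum_val a j = enum_val a' j.
      by rewrite ei; apply: IH.
    apply/val_inj/eqP; rewrite eqn_leq (key _ _ _ _ _ hm em eq_lt).
    by rewrite (key _ _ _ _ _ hm' (esym em)) // => j /eq_lt.
  by apply/enum_val_inj/ffunP=> i; apply: (eq_b d.+1).
move=> a v /imsetP[[i c]]; rewrite inE /= => /andP[ltcb /forall_inP ltbc] ->.
have b_incr := elimT (increasingP _) (minor_index_incr a).
pose i' : 'I_d.+2 := widen_ord (leqnSn _) i.
(* The sequence of [a] with [c] inserted at position [i]; omitting position [i'] gives [a] back. *)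
pose u (k : 'I_d.+2) := if unlift i' k is Some j then enum_val a j else c.
have u_lift j : u (lift i' j) = enum_val a j by rewrite /u liftK.
have u_i : u i' = c by rewrite /u unlift_none.
have u_incr (k l : 'I_d.+2) : (k < l)%N -> (u k < u l)%N.
  case: (unliftP i' k) => [j|] ->; case: (unliftP i' l) => [j'|] ->; rewrite ?u_lift ?u_i.
  - by move=> h; apply: b_incr; move: h; rewrite /= /bump; lia.
  - by move=> h; apply: ltbc; move: h; rewrite /= /bump; lia.
  - move=> h; apply: leq_trans ltcb _.
    have : (i <= j')%N by move: h; rewrite /= /bump; lia.
    by rewrite leq_eqVlt => /orP[/eqP/val_inj->//|/b_incr/ltnW].
  - by rewrite ltnn.
have lift_incr (k : 'I_d.+2) : increasing (fun j : 'I_d.+1 => u (lift k j)).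
  apply/increasingP=> j l ltjl; apply: u_incr.
  by rewrite /= ltnNge leq_bump2 -ltnNge.
have h (k : 'I_d.+2) : exists ak : 'I_#|B|, enum_val ak =1 (fun j : 'I_d.+1 => u (lift k j)).
  exact: minor_indexP (lift_incr k) (D_full (lift_incr k)).
case: (fin_all_exists h) => f hf.
have f_i : f i' = a by apply/enum_val_inj/ffunP=> j; rewrite hf u_lift.
rewrite -u_i.
(* The additional sign from [i'] normalizes the coefficient at [k = i'] to 1. *)
exists (\sum_(k < d.+2) ((-1) ^+ (i' + k) *: 'X_(mxvec_index i (u k)) : S) *: delta_mx 0 (f k)).
  have := congr1 (fun p => (-1) ^+ i' *: p) (minor_relation K u i).
  rewrite scaler0 => rel0; apply/matrixP=> x y; rewrite !ord1 [RHS]mxE -[RHS]rel0.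
  rewrite mulmx_suml summxE scaler_sumr; apply: eq_bigr => k _.
  rewrite -scalemxAl -rowE !mxE (eq_maximal_minor K (hf k)).
  by rewrite scalerA -exprD scalerAl.
rewrite (bigD1 i') //= f_i -signr_odd oddD addbb scale1r [X in supported _ X]addrAC subrr add0r.
apply: supported_sum => k nk; apply: supported_term.
rewrite /lower mdeg1 wdegU !minor_wtE /= [X in (X < _)%N]addnC [X in (_ < X)%N]addnC.
rewrite /minor_shift.
under eq_bigr do rewrite hf.
under [X in (_ < X + _)%N]eq_bigr do rewrite -u_lift.
by apply: (relation_weight_lt (u := fun k => u k : nat)).
Qed.

End MaximalMinors.

(** * Graded parts of products *)

Lemma pihomogM_lt (K : fieldType) N t D (x q : {mpoly K[N]}) :
  q \is D.-homog -> (t < D)%N -> pihomog mdeg t (x * q) = 0.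
Proof.
move=> hq lttD; rewrite [x]mpolyE mulr_suml raddf_sum /=.
apply: big1 => m _; rewrite -scalerAl linearZ /=.
rewrite (@pihomog_ne0 _ _ _ (mdeg m + D)%N) ?scaler0 //; first by rewrite gtn_eqF // ltn_addl.
by apply: dhomogM => //; rewrite dhomogX.
Qed.

Lemma pihomogM (K : fieldType) N D (x q : {mpoly K[N]}) :
  q \is D.-homog -> pihomog mdeg D (x * q) = (x@_0%MM)%:MP * q.
Proof.
move=> hq; have [h0|h0] := boolP (0%MM \in msupp x).
  rewrite {1}[x]mpolyE mulr_suml raddf_sum /= (bigD1_seq _ h0) ?msupp_uniq //=.
  rewrite big1 ?addr0 => [|m nm].
    by rewrite mpolyX0 -scalerAl mul1r linearZ /= pihomog_dE // mul_mpolyC.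
  rewrite -scalerAl linearZ /= (@pihomog_ne0 _ _ _ (mdeg m + D)%N) ?scaler0 //.
    by rewrite -[X in _ != X]add0n eqn_add2r mdeg_eq0.
  by apply: dhomogM => //; rewrite dhomogX.
rewrite (memN_msupp_eq0 h0) mpolyC0 mul0r {1}[x]mpolyE mulr_suml raddf_sum /=.
rewrite big_seq big1 // => m hm.
rewrite -scalerAl linearZ /= (@pihomog_ne0 _ _ _ (mdeg m + D)%N) ?scaler0 //.
  rewrite -[X in _ != X]add0n eqn_add2r mdeg_eq0.
  by apply: contraNneq h0 => <-.
by apply: dhomogM => //; rewrite dhomogX.
Qed.

(** In degree [D] only the constant terms of [A] contribute. Thus generators of equal degree are
    related by scalar matrices. *)
Lemma homog_mulmx_const (K : fieldType) N D p q r
    (g : 'M[{mpoly K[N]}]_(p, r)) A (g' : 'M[{mpoly K[N]}]_(q, r)) :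
    (forall i j, g i j \is D.-homog) -> (forall i j, g' i j \is D.-homog) ->
  g = A *m g' -> g = map_mx (@mpolyC N K) (map_mx (mcoeff 0%MM) A) *m g'.
Proof.
move=> hg hg' eg; apply/matrixP=> i j; rewrite -(pihomog_dE (hg i j)) {1}eg.
rewrite !mxE raddf_sum /=; apply: eq_bigr => k _.
by rewrite !mxE pihomogM.
Qed.

(** * Specialization of columns *)

Section Specialization.
Variables (K : fieldType) (d n : nat).
Notation N := (d.+1 * n)%N.
Notation S := {mpoly K[N]}.
Implicit Types (f : 'I_n -> option 'I_n) (p : S).

Definition subst_mx (Y : 'M[S]_(d.+1, n)) : S -> S :=
  comp_mpoly [tuple mxvec Y 0 k | k < N].

HB.instance Definition _ Y := GRing.RMorphism.on (subst_mx Y).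

Lemma subst_mxX Y i j : subst_mx Y 'X_(mxvec_index i j) = Y i j.
Proof. by rewrite /subst_mx comp_mpolyXU -tnth_nth tnth_mktuple mxvecE. Qed.

Lemma subst_mxZ Y c p : subst_mx Y (c *: p) = c *: subst_mx Y p.
Proof. exact: comp_mpolyZ. Qed.

Lemma subst_mx_minor Y (b : 'I_d.+1 -> 'I_n) :
  subst_mx Y (maximal_minor K b) = \det (colsub b Y).
Proof.
rewrite /maximal_minor -det_map_mx; congr (\det _).
by apply/matrixP=> i j; rewrite !mxE /= subst_mxX.
Qed.

Lemma subst_mx_linear Y p : p \is 1.-homog ->
  subst_mx Y p = \sum_i \sum_j p@_U_(mxvec_index i j) *: Y i j.
Proof.
move=> hp; have {1}-> : p = \sum_i \sum_j p@_U_(mxvec_index i j) *: 'X_(mxvec_index i j).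
  apply/mpolyP=> m; have [/mdeg1P[k /eqP->]|nm] := boolP (mdeg m == 1%N); last first.
    rewrite (dhomog_nemf_coeff hp nm) raddf_sum /= big1 // => i _.
    rewrite raddf_sum /= big1 // => j _; rewrite mcoeffZ mcoeffX.
    by case: (_ =P m) nm => [<-|_ _]; rewrite ?mdeg1 ?mulr0.
  case/mxvec_indexP: k => i j; rewrite raddf_sum /= (bigD1 i) //=.
  rewrite raddf_sum /= (bigD1 j) //= mcoeffZ mcoeffX eqxx mulr1.
  rewrite big1 ?addr0 => [|j' nj]; last first.
    by rewrite mcoeffZ mcoeffXU mxvec_index_eq eqxx (negPf nj) mulr0.
  rewrite big1 ?addr0 // => i' ni; rewrite raddf_sum /= big1 // => j' _.
  by rewrite mcoeffZ mcoeffXU mxvec_index_eq (negPf ni) mulr0.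
rewrite rmorph_sum; apply: eq_bigr => i _; rewrite rmorph_sum; apply: eq_bigr => j _.
by rewrite /= subst_mxZ subst_mxX.
Qed.

(** Substituting unit vectors for the columns [b] turns the minor into 1. *)
Lemma maximal_minor_neq0 (b : 'I_d.+1 -> 'I_n) :
  injective b -> maximal_minor K b != 0.
Proof.
move=> b_inj; apply/eqP=> /(congr1 (subst_mx (\matrix_(i, j) (j == b i)%:R))).
rewrite rmorph0 subst_mx_minor.
have -> : colsub b (\matrix_(i, j) (j == b i)%:R) = 1%:M :> 'M[S]_d.+1.
  by apply/matrixP=> i j; rewrite !mxE (inj_eq b_inj) eq_sym.
by rewrite det1 => /eqP; rewrite oner_eq0.
Qed.

(** [Some k] turns a column into column [k], and [None] sets it to zero. Columns with the same image
    become equal. *)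
Definition colmap f : S -> S :=
  subst_mx (\matrix_(i, j) if f j is Some k then 'X_(mxvec_index i k) else 0).

HB.instance Definition _ f := GRing.RMorphism.on (colmap f).

Lemma colmapC f (c : K) : colmap f c%:MP = c%:MP.
Proof. exact: comp_mpolyC. Qed.

Lemma colmap_minor f (b b' : 'I_d.+1 -> 'I_n) :
  (forall j, f (b j) = Some (b' j)) -> colmap f (maximal_minor K b) = maximal_minor K b'.
Proof.
move=> h; rewrite /colmap subst_mx_minor; congr (\det _).
by apply/matrixP=> i j; rewrite !mxE h.
Qed.

Lemma colmap_minor_none f (b : 'I_d.+1 -> 'I_n) j :
  f (b j) = None -> colmap f (maximal_minor K b) = 0.
Proof.
move=> h; rewrite /colmap subst_mx_minor (expand_det_col _ j) big1 // => i _.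
by rewrite !mxE h mul0r.
Qed.

Lemma colmap_minor_eq f (b : 'I_d.+1 -> 'I_n) j l :
  j != l -> f (b j) = f (b l) -> colmap f (maximal_minor K b) = 0.
Proof.
move=> njl h; rewrite /colmap subst_mx_minor -det_tr.
by apply: (determinant_alternate njl) => i; rewrite !mxE h.
Qed.

Lemma colmap_linear_eq0 f p : p \is 1.-homog ->
  (forall i j, f j != None -> p@_U_(mxvec_index i j) = 0) -> colmap f p = 0.
Proof.
move=> hp h; rewrite /colmap subst_mx_linear // big1 // => i _; rewrite big1 // => j _.
rewrite mxE; case ej: (f j) => [k|]; last by rewrite scaler0.
by rewrite h ?scale0r ?ej.
Qed.

Lemma colmap_linear_coeff f p i k : p \is 1.-homog -> colmap f p = 0 ->
  \sum_(j | f j == Some k) p@_U_(mxvec_index i j) = 0.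
Proof.
move=> hp /(congr1 (mcoeff U_(mxvec_index i k))); rewrite mcoeff0 => e0; rewrite -[RHS]e0.
rewrite /colmap subst_mx_linear // raddf_sum /= (bigD1 i) //= [X in _ + X]big1 ?addr0.
  rewrite raddf_sum /= big_mkcond; apply: eq_bigr => j _.
  rewrite mxE mcoeffZ; case: (f j) => [k'|] /=; last by rewrite mcoeff0 mulr0.
  rewrite mcoeffXU mxvec_index_eq eqxx /= -[Some k' == _]/(k' == k).
  by case: (k' == k); rewrite ?mulr1 ?mulr0.
move=> i' ni; rewrite raddf_sum /= big1 // => j _; rewrite mxE mcoeffZ.
case: (f j) => [k'|]; last by rewrite mcoeff0 mulr0.
by rewrite mcoeffXU mxvec_index_eq (negPf ni) mulr0.
Qed.
End Specialization.

(** * Increasing maps as subsets *)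

Section IncreasingMaps.
Variables (p n : nat).
Implicit Types b : {ffun 'I_p -> 'I_n}.

Lemma increasing_inj b : increasing b -> injective b.
Proof.
move=> /increasingP h i j eb; case: (ltngtP i j) => [/h|/h|/val_inj //]; by rewrite eb ltnn.
Qed.

Lemma increasing_eq b b' : increasing b -> increasing b' ->
  [set b i | i : 'I_p] = [set b' i | i : 'I_p] -> b = b'.
Proof.
have srt b1 : increasing b1 -> sorted ltn [seq val (b1 i) | i <- enum 'I_p].
  move=> /increasingP h; rewrite sorted_map.
  have : sorted ltn (map val (enum 'I_p)) by rewrite val_enum_ord iota_ltn_sorted.
  by rewrite sorted_map; apply: sub_sorted => i j /= /h.
move=> /srt s1 /srt s2 e_im.
have : [seq val (b i) | i <- enum 'I_p] = [seq val (b' i) | i <- enum 'I_p].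
  apply: (irr_sorted_eq ltn_trans ltnn s1 s2) => m.
  have mem_im b1 : (m \in [seq val (b1 i) | i <- enum 'I_p]) =
      (m \in [seq val c | c <- enum [set b1 i | i : 'I_p]]).
    apply/mapP/mapP=> [[i _ ->]|[c]].
      by exists (b1 i); rewrite // mem_enum imset_f.
    by rewrite mem_enum => /imsetP[i _ ->] ->; exists i; rewrite ?mem_enum.
  by rewrite !mem_im e_im.
move/eq_in_map => h; apply/ffunP=> i; apply/val_inj/h; exact: mem_enum.
Qed.

Lemma increasing_exists (F : {set 'I_n}) : #|F| = p ->
  exists2 b, increasing b & [set b i | i : 'I_p] = F.
Proof.
(* [nth] needs a default vertex, so the case of empty [F], where [p = 0], is split off. *)
move=> cF; case: (pickP (mem F)) => [c0 _|F0]; last first.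
  have p0 : p = 0%N by rewrite -cF; apply/eqP; rewrite cards_eq0; apply/eqP/setP=> c; rewrite inE [LHS]F0.
  have no (i : 'I_p) : False by have := ltn_ord i; rewrite [X in (_ < X)%N]p0.
  exists [ffun i => False_rect _ (no i)]; first by apply/increasingP=> i.
  by apply/setP=> c; rewrite [RHS]F0; apply/imsetP=> -[i]; case: (no i).
have szF : size (enum F) = p by rewrite -cardE.
have srt : sorted (fun x y : 'I_n => x < y)%N (enum F).
  rewrite /enum_mem; apply: sorted_filter => [x y z|]; first exact: ltn_trans.
  have : sorted ltn (map val (enum 'I_n)) by rewrite val_enum_ord iota_ltn_sorted.
  by rewrite -enumT sorted_map.
exists [ffun i : 'I_p => nth c0 (enum F) i].
  apply/increasingP=> i j ltij; rewrite !ffunE.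
  apply: (sorted_ltn_nth _ c0 srt); rewrite ?inE ?szF //.
  by move=> x y z; exact: ltn_trans.
apply/setP=> c; apply/imsetP/idP => [[i _ ->]|cF'].
  by rewrite ffunE -mem_enum mem_nth // szF.
rewrite -mem_enum in cF'.
have lt_p : (index c (enum F) < p)%N by rewrite -szF index_mem.
by exists (Ordinal lt_p); rewrite // ffunE nth_index.
Qed.
End IncreasingMaps.

(** * Linear syzygies of the facet minors *)

Section LinearSyzygies.
Variables (K : fieldType) (d n : nat) (D : {set {set 'I_n}}).
Notation N := (d.+1 * n)%N.
Notation S := {mpoly K[N]}.
Notation B := (minor_indices d D).
Implicit Types (a : 'I_#|B|) (s : 'rV[S]_#|B|).

Definition columns a : {set 'I_n} := [set enum_val a i | i : 'I_d.+1].

Lemma columns_mem a : columns a \in D.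
Proof. by have := enum_valP a; rewrite inE => /andP[]. Qed.

Lemma index_inj a : injective (enum_val a).
Proof. exact/increasing_inj/minor_index_incr. Qed.

Lemma card_columns a : #|columns a| = d.+1.
Proof. by rewrite card_imset ?card_ord //; apply: index_inj. Qed.

Lemma columns_inj : injective columns.
Proof.
move=> a a' e_im; apply/enum_val_inj/increasing_eq => //; exact: minor_index_incr.
Qed.

Lemma columns_exists (F : {set 'I_n}) : F \in D -> #|F| = d.+1 ->
  exists a, columns a = F.
Proof.
move=> FD /increasing_exists[b b_incr bF].
have [|a ea] := minor_indexP (D := D) b_incr; first by rewrite bF.
by exists a; rewrite -bF; apply: eq_imset.
Qed.

(** Only the product at [a] survives the specialization, and the polynomial ring is a domain. *)
Lemma syzygy_colmap f a s : s *m minors K d D = 0 ->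
    (forall a', a' != a -> colmap f (maximal_minor K (enum_val a')) = 0) ->
    colmap f (maximal_minor K (enum_val a)) != 0 ->
  colmap f (s 0 a) = 0.
Proof.
move=> /matrixP/(_ 0 0); rewrite !mxE => s0 kill nz.
move/(congr1 (colmap f)): s0; rewrite rmorph0 rmorph_sum (bigD1 a) //= big1 => [|a' na].
  by rewrite addr0 rmorphM mxE => /eqP; rewrite mulf_eq0 (negPf nz) orbF => /eqP.
by rewrite rmorphM mxE /= kill ?mulr0.
Qed.

Definition restrict (F : {set 'I_n}) (j : 'I_n) := if j \in F then Some j else None.

Lemma colmap_restrict_eq0 a a' : a' != a ->
  colmap (restrict (columns a)) (maximal_minor K (enum_val a')) = 0.
Proof.
move=> na; have /subsetPn[c /imsetP[j _ ->] hj] : ~~ (columns a' \subset columns a).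
  apply: contra na => sub; apply/eqP/columns_inj/eqP.
  by rewrite eqEcard sub !card_columns /=.
by apply: (@colmap_minor_none _ _ _ _ _ j); rewrite /restrict (negPf hj).
Qed.

Lemma colmap_restrict_id a :
  colmap (restrict (columns a)) (maximal_minor K (enum_val a)) =
  maximal_minor K (enum_val a).
Proof. by apply: colmap_minor => j; rewrite /restrict imset_f. Qed.

Lemma syzygy_restrict a s :
  s *m minors K d D = 0 -> colmap (restrict (columns a)) (s 0 a) = 0.
Proof.
move=> s0; apply: (syzygy_colmap s0) => [a' na|].
  exact: colmap_restrict_eq0.
by rewrite colmap_restrict_id maximal_minor_neq0 //; apply: index_inj.
Qed.

(** Setting the columns outside [columns a] to zero isolates the minor of [a] and leaves the
    variables of column [h] untouched. *)
Lemma linear_syzygy_in a s i h : s *m minors K d D = 0 -> s 0 a \is 1.-homog ->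
  h \in columns a -> (s 0 a)@_U_(mxvec_index i h) = 0.
Proof.
move=> s0 hs ha; have := colmap_linear_coeff i h hs (syzygy_restrict a s0).
rewrite (big_pred1 h) // => j; rewrite /restrict.
by case: ifP => [_|ja] /=; [ | apply/esym; apply: contraFF ja => /eqP->].
Qed.

(** Set the columns outside [g |: columns a] to zero and replace column [h] by column [g]. Minors
    using both [g] and [h] vanish, the one omitting [h] does not occur, and only [a] omits [g]. So
    the coefficients at [g] and [h] add up to zero, and the one at [h] is zero by
    [linear_syzygy_in]. *)
Lemma linear_syzygy_out a s i g h :
    s *m minors K d D = 0 -> s 0 a \is 1.-homog ->
    g \notin columns a -> h \in g |: columns a -> (g |: columns a) :\ h \notin D ->
  (s 0 a)@_U_(mxvec_index i g) = 0.
Proof.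
move=> s0 hs ga; rewrite !inE => /orP[/eqP->|ha].
  by rewrite setU1K // columns_mem.
move=> hD; have ngh : g != h by apply: contraNneq ga => ->.
pose U := g |: columns a.
have cU : #|U| = d.+2 by rewrite cardsU1 ga card_columns.
pose f j := if j \in U then Some (if j == h then g else j) else None.
have kill : colmap f (s 0 a) = 0.
  apply: (syzygy_colmap s0) => [a' na|].
    have [sub|/subsetPn[c /imsetP[j _ ->] hj]] := boolP (columns a' \subset U); last first.
      by apply: (@colmap_minor_none _ _ _ _ _ j); rewrite /f (negPf hj).
    have in_a' x : x \in U -> U :\ x != columns a' -> x \in columns a'.
      move=> xU; apply: contraNT => xa'; rewrite eq_sym eqEcard subsetD1 sub xa' /=.
      by have := cardsD1 x U; rewrite xU cU add1n card_columns => -[<-].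
    have /imsetP[j _ ej] : g \in columns a'.
      apply: in_a'; first by rewrite !inE eqxx.
      by rewrite setU1K //; apply: contraNneq na => /columns_inj->.
    have /imsetP[l _ el] : h \in columns a'.
      apply: in_a'; first by rewrite !inE ha orbT.
      by apply: contraNneq hD => ->; apply: columns_mem.
    apply: (@colmap_minor_eq _ _ _ _ _ j l).
      by apply: contraNneq ngh => ejl; rewrite ej el ejl.
    by rewrite /f -ej -el eqxx (negPf ngh) !inE eqxx ha orbT.
  rewrite (@colmap_minor _ _ _ _ _ (fun j => if enum_val a j == h then g else enum_val a j)).
    apply: maximal_minor_neq0 => j l; case: eqP => [ej|_]; case: eqP => [el|_].
    - by move=> _; apply: (@index_inj a); rewrite ej el.
    - by move=> eg; rewrite eg imset_f in ga.
    - by move=> eg; rewrite -eg imset_f in ga.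
    - exact: index_inj.
  by move=> j; rewrite /f !inE imset_f ?orbT.
have := colmap_linear_coeff i g hs kill.
rewrite (bigD1 g) /=; last by rewrite /f !inE eqxx (negPf ngh).
rewrite (bigD1 h) /=; last by rewrite /f !inE ha eqxx orbT eqxx eq_sym ngh.
rewrite (linear_syzygy_in _ s0 hs ha) add0r big1 ?addr0 // => j.
rewrite /f; case: (j \in U) => //; case: (j =P h) => [->|_]; rewrite ?eqxx ?andbF //=.
by rewrite -[Some j == _]/(j == g); case: eqP.
Qed.

(** The specialization isolating [a] fixes constants, so it can kill only a zero coefficient. *)
Lemma minors_linear_independent (c : 'rV[K]_#|B|) :
  map_mx (@mpolyC N K) c *m minors K d D = 0 -> c = 0.
Proof.
move=> c0; apply/rowP=> a; apply/eqP; rewrite mxE -(mpolyC_eq0 N).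
by have /eqP := syzygy_restrict a c0; rewrite mxE colmapC.
Qed.

Section Exchange.
Variables (r0 r1 : nat) (aug : 'cV[S]_r0) (phi : 'M[S]_(r1, r0)).
Hypothesis aug_homog : forall i, aug i 0 \is d.+1.-homog.
Hypothesis phi_homog : forall i j, phi i j \is 1.-homog.
Hypothesis aug_image : forall p, determinantal_facet_ideal K d D p <->
  exists v : 'rV_r0, p = (v *m aug) 0 0.
Hypothesis phi_exact : forall v : 'rV_r0, v *m aug = 0 <-> exists w, v = w *m phi.

(** The scalar matrices [A] and [C] translate between the generators of the resolution and the
    minors. The rows of [T] are then linear syzygies of the minors, and they generate the Koszul
    syzygy [y]. *)
Lemma exchange a a' : a != a' -> exists2 g, g \in columns a' :\: columns a &
  forall h, h \in g |: columns a -> (g |: columns a) :\ h \in D.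
Proof.
move=> naa'.
have minors_homog i j : minors K d D i j \is d.+1.-homog.
  by rewrite mxE; apply: maximal_minor_homog.
have aug_homog' i j : aug i j \is d.+1.-homog by rewrite ord1.
have [A augE] : exists A, aug = map_mx (@mpolyC N K) A *m minors K d D.
  have h i : exists v : 'rV_#|B|, aug i 0 = (v *m minors K d D) 0 0.
    apply: (determinantal_facet_idealE D (aug i 0)).1; apply/aug_image; exists (delta_mx 0 i).
    by rewrite -rowE [RHS]mxE.
  case: (fin_all_exists h) => v hv; eexists.
  apply: (homog_mulmx_const (A := \matrix_i v i)) => //; apply/matrixP=> i j.
  by rewrite ord1 hv !mxE; apply: eq_bigr => k _; rewrite !mxE.
have [C minorsE] : exists C, minors K d D = map_mx (@mpolyC N K) C *m aug.
  have h i : exists v : 'rV_r0, minors K d D i 0 = (v *m aug) 0 0.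
    apply/aug_image; apply: (determinantal_facet_idealE D _).2; exists (delta_mx 0 i).
    by rewrite -rowE [RHS]mxE.
  case: (fin_all_exists h) => v hv; eexists.
  apply: (homog_mulmx_const (A := \matrix_i v i)) => //; apply/matrixP=> i j.
  by rewrite ord1 hv !mxE; apply: eq_bigr => k _; rewrite !mxE.
(* By linear independence of the minors; this carries [y] to the resolution and back unchanged. *)
have CA : C *m A = 1%:M.
  apply/eqP; rewrite -subr_eq0; apply/eqP/row_matrixP=> x; rewrite row0.
  apply: minors_linear_independent; rewrite map_row -row_mul map_mxB map_mxM map_mx1.
  by rewrite mulmxBl mul1mx -mulmxA -augE -minorsE subrr row0.
pose T := phi *m map_mx (@mpolyC N K) A.
have T0 k : row k T *m minors K d D = 0.
  rewrite -row_mul -mulmxA -augE row_mul; apply/phi_exact.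
  by exists (delta_mx 0 k); rewrite rowE.
have T_homog k j : row k T 0 j \is 1.-homog.
  rewrite !mxE; apply: rpred_sum => x _; rewrite mxE mulrC mul_mpolyC.
  exact: rpredZ.
pose m (x : 'I_#|B|) := maximal_minor K (enum_val x).
pose y : 'rV[S]_#|B| := m a' *: delta_mx 0 a - m a *: delta_mx 0 a'.
have y0 : y *m minors K d D = 0.
  rewrite mulmxBl -!scalemxAl -!rowE; apply/rowP=> j; rewrite !mxE mulrC.
  by rewrite subrr.
have [w yE] : exists w, y = w *m T.
  have [|w ew] := (phi_exact (y *m map_mx (@mpolyC N K) C)).1.
    by rewrite -mulmxA -minorsE.
  exists w; rewrite /T mulmxA -ew -mulmxA -map_mxM CA map_mx1.
  by rewrite mulmx1.
have mE : m a' = \sum_k w 0 k * T k a.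
  have := congr1 (fun M : 'rV_#|B| => M 0 a) yE; rewrite !mxE !eqxx (negPf naa') /=.
  by rewrite mulr1 mulr0 subr0.
(* If no [g] qualified, each [T k a] would vanish once the columns outside [columns a'] are zero,
   whereas [m a'] survives. *)
have [/exists_inP[g gD /forall_inP hg]|/exists_inPn no_g] :=
    boolP [exists g in columns a' :\: columns a,
             [forall h in g |: columns a, (g |: columns a) :\ h \in D]].
  by exists g.
have := congr1 (colmap (restrict (columns a'))) mE.
rewrite colmap_restrict_id rmorph_sum big1 => [/eqP|k _].
  by rewrite (negPf (maximal_minor_neq0 _ (@index_inj a'))).
rewrite rmorphM /= [X in _ * X](_ : _ = 0) ?mulr0 //.
have Tka : T k a = row k T 0 a by rewrite [RHS]mxE.
rewrite Tka; apply: colmap_linear_eq0 => // i g.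
rewrite /restrict; case: ifP => // ga' _.
have [ga|ga] := boolP (g \in columns a); first exact: linear_syzygy_in.
have /forall_inPn[h hU hD] : ~~ [forall h in g |: columns a, (g |: columns a) :\ h \in D].
  by apply: no_g; rewrite inE ga ga'.
exact: linear_syzygy_out hU hD.
Qed.
End Exchange.
End LinearSyzygies.

(** * Completeness from the exchange property *)

Section Complete.
Variables (n d : nat) (D : {set {set 'I_n}}).
Hypothesis hD : simplicial_complex D.
Hypothesis hpure : pure_dim d D.

Lemma pure_extend (F : {set 'I_n}) : F \in D ->
  exists G : {set 'I_n}, [/\ F \subset G, G \in D & #|G| = d.+1].
Proof.
move=> /maxset_exists[G Gmax FG]; exists G; split=> //.
  by case/maxsetP: Gmax.
exact: hpure.
Qed.

Hypothesis D_exchange : forall F G : {set 'I_n}, F \in D -> G \in D ->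
    #|F| = d.+1 -> #|G| = d.+1 -> F != G ->
  exists2 g, g \in G :\: F & forall h, h \in g |: F -> (g |: F) :\ h \in D.

Lemma card_swap (F : {set 'I_n}) g h :
  g \notin F -> h \in F -> #|(g |: F) :\ h| = #|F|.
Proof.
move=> gF hF; have := cardsD1 h (g |: F).
by rewrite cardsU1 gF !inE hF orbT => -[].
Qed.

(** Let [G] be a facet through [t] with the largest overlap with [F]. If [t] is its only vertex
    outside [F], the exchange must use [t]. Otherwise trading another such vertex [u] for some [f]
    in [F] would increase the overlap. *)
Lemma exchange_any (F : {set 'I_n}) t : F \in D -> #|F| = d.+1 -> t \notin F ->
  forall h, h \in t |: F -> (t |: F) :\ h \in D.
Proof.
move=> FD cF tF.
have [G0 [tG0 G0D cG0]] : exists G : {set 'I_n}, [/\ [set t] \subset G, G \in D & #|G| = d.+1].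
  by apply: pure_extend; case: hD.
pose P (G : {set 'I_n}) := [&& t \in G, G \in D & #|G| == d.+1].
have PG0 : P G0 by rewrite /P -sub1set tG0 G0D cG0 eqxx.
case: (@arg_maxnP _ G0 P (fun G => #|G :&: F|) PG0) => G /and3P[tG GD /eqP cG] Gmax.
have neFG : F != G by apply: contraNneq tF => ->.
have [/set0Pn[u]|/negPn/eqP GFt] := boolP ((G :\: F) :\ t != set0); last first.
  have [g gGF hg] := D_exchange FD GD cF cG neFG.
  suff <- : g = t by [].
  by apply/eqP/negPn/negP=> ngt; have := in_set0 g; rewrite -GFt in_setD1 ngt gGF.
rewrite !inE => /and3P[nut uF uG].
rewrite eq_sym in neFG; have [f] := D_exchange GD FD cG cF neFG.
rewrite inE => /andP[fG fF] hf.
have PG' : P ((f |: G) :\ u).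
  rewrite /P card_swap // cG eqxx andbT hf ?inE ?uG ?orbT // tG eq_sym nut orbT.
  by [].
have /= := Gmax _ PG'; rewrite leqNgt => /negP[].
have -> : ((f |: G) :\ u) :&: F = f |: (G :&: F).
  apply/setP=> x; rewrite !inE; have [->|nxf] := eqVneq x f.
    by rewrite fF andbT /= (contraNneq _ uF) // => <-.
  have [->|nxu] := eqVneq x u; first by rewrite (negPf uF) !andbF.
  by [].
by rewrite cardsU1 inE (negPf fG) add1n.
Qed.

(** A facet with the largest overlap with a given [T] of [d.+1] vertices must be [T], since
    [exchange_any] could otherwise trade a vertex outside [T] for one inside. *)
Lemma exchange_complete : D = skeleton d (simplex n).
Proof.
have setn F : F \in simplex n by rewrite inE subsetT.
case: hD => D0 D1 Dsub.
have full (T : {set 'I_n}) : #|T| = d.+1 -> T \in D.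
  move=> cT; have [F0 [_ F0D cF0]] := pure_extend D0.
  pose P (F : {set 'I_n}) := (F \in D) && (#|F| == d.+1).
  have PF0 : P F0 by rewrite /P F0D cF0 eqxx.
  case: (@arg_maxnP _ F0 P (fun F => #|F :&: T|) PF0) => F /andP[FD /eqP cF] Fmax.
  have [<- //|neFT] := eqVneq F T.
  have /subsetPn[f fF fT] : ~~ (F \subset T).
    by apply: contra neFT => sub; rewrite eqEcard sub cT cF /=.
  have /subsetPn[t tT tF] : ~~ (T \subset F).
    by apply: contra neFT => sub; rewrite eq_sym eqEcard sub cT cF /=.
  have PF' : P ((t |: F) :\ f).
    by rewrite /P card_swap // cF eqxx andbT (exchange_any FD) // !inE fF orbT.
  have /= := Fmax _ PF'; rewrite leqNgt => /negP[].
  have -> : ((t |: F) :\ f) :&: T = t |: (F :&: T).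
    apply/setP=> x; rewrite !inE; have [->|nxt] := eqVneq x t.
      by rewrite tT andbT /= (contraNneq _ fT) // => <-.
    have [->|//] := eqVneq x f; by rewrite (negPf fT) !andbF.
  by rewrite cardsU1 inE (negPf tF) add1n.
apply/setP=> F; rewrite !inE subsetT /=; apply/idP/idP=> [FD|cF].
  by have [G [FG _ <-]] := pure_extend FD; apply: subset_leq_card.
(* Existence of a facet gives [d.+1 <= n], which leaves room to enlarge [F] to [d.+1] vertices. *)
have [G0 [_ G0D cG0]] := pure_extend D0.
have cn : (d.+1 <= n)%N by rewrite -cG0 -[n in (_ <= n)%N]card_ord max_card.
have [T FT cT] : exists2 T : {set 'I_n}, F \subset T & #|T| = d.+1.
  have [k ek] : exists k, (#|F| + k = d.+1)%N by exists (d.+1 - #|F|)%N; rewrite subnKC.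
  elim: k F ek {cF} => [|k IH] F ek; first by exists F; rewrite // -ek addn0.
  have /subsetPn[x _ xF] : ~~ ([set: 'I_n] \subset F).
    apply: contraL cn => /subset_leq_card; rewrite cardsT card_ord -ltnNge -ek => le.
    by rewrite (leq_ltn_trans le) // addnS ltnS leq_addr.
  have [|T xT cT] := IH (x |: F); first by rewrite cardsU1 xF add1n addSnnS.
  by exists T => //; apply: subset_trans xT; apply: subsetUr.
exact: Dsub (full _ cT) FT.
Qed.
End Complete.

(** * The two implications *)

Lemma skeleton_linear_resolution (K : fieldType) d n :
  has_linear_resolution (determinantal_facet_ideal K d (skeleton d (simplex n))).
Proof.
have D_full (b : 'I_d.+1 -> 'I_n) : increasing b ->
    [set b i | i : 'I_d.+1] \in skeleton d (simplex n).
  move=> b_incr; rewrite !inE subsetT /= -[X in (_ <= X)%N]card_ord.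
  exact: leq_imset_card.
apply: (linear_resolution_of_involutive (minors_involutive K D_full)) => [a|p].
  by rewrite mxE; apply: maximal_minor_homog.
exact: determinantal_facet_idealE.
Qed.

(** The minors and the generators of the resolution generate the same nonzero ideal, so neither
    family can lie in a lower degree than the other. This gives [t = d.+1], as [exchange]
    requires. *)
Lemma linear_resolution_complete (K : fieldType) d n (D : {set {set 'I_n}}) :
    simplicial_complex D -> pure_dim d D ->
    has_linear_resolution (determinantal_facet_ideal K d D) ->
  D = skeleton d (simplex n).
Proof.
move=> hD hpure [t [F [_ linF]]].
have aug_t i : res_aug F i 0 \is t.-homog.
  by rewrite -[t]addn0 -(linF 0%N i); apply: res_aug_homog.
have [G [_ GD cG]] := pure_extend hpure (let: And3 D0 _ _ := hD in D0).
have [a0 _] := columns_exists GD cG.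
have m_neq0 : maximal_minor K (enum_val a0) != 0.
  exact/maximal_minor_neq0/index_inj.
have [v0 ev0] : exists v : 'rV_(res_rank F 0), minors K d D a0 0 = (v *m res_aug F) 0 0.
  apply/(res_aug_image F); apply: (determinantal_facet_idealE D _).2; exists (delta_mx 0 a0).
  by rewrite -rowE [RHS]mxE.
have m_homog a : minors K d D a 0 \is d.+1.-homog.
  by rewrite mxE; apply: maximal_minor_homog.
have aug0_absurd : (forall i, res_aug F i 0 = 0) -> False.
  move=> aug0; case/eqP: m_neq0; move: ev0; rewrite !mxE => ->.
  by rewrite big1 // => i _; rewrite aug0 mulr0.
have et : t = d.+1.
  case: (ltngtP t d.+1) => // [ltt|gtt].
    case: aug0_absurd => i.
    have [v ev] : exists v : 'rV_#|minor_indices d D|,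
        res_aug F i 0 = (v *m minors K d D) 0 0.
      apply: (determinantal_facet_idealE D _).1; apply/(res_aug_image F).
      by exists (delta_mx 0 i); rewrite -rowE [RHS]mxE.
    rewrite -(pihomog_dE (aug_t i)) ev mxE raddf_sum big1 // => k _.
    exact: (pihomogM_lt _ (m_homog k)).
  case/eqP: m_neq0; have := pihomog_dE (m_homog a0).
  rewrite ev0 {1}mxE raddf_sum big1 => [|k _]; last exact: (pihomogM_lt _ (aug_t k)).
  by rewrite -ev0 mxE => <-.
subst t.
have phi_homog i j : res_map F 0 i j \is 1.-homog.
  have := res_map_homog i j; rewrite !linF leq_add2l leqnSn subnDl.
  by [].
apply: (exchange_complete hD hpure) => F1 G1 F1D G1D cF1 cG1 neFG.
have [a ea] := columns_exists F1D cF1; have [a' ea'] := columns_exists G1D cG1.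
have [|g] := exchange aug_t phi_homog (res_aug_image F) (@res_exact0 _ _ _ F) (a := a) (a' := a').
  by apply: contraNneq neFG => eaa; rewrite -ea -ea' eaa.
by rewrite ea ea'; exists g.
Qed.

Local Close Scope ring_scope.

Theorem corollary81 (K : fieldType) (d n : nat) (D : {set {set 'I_n}})
    (hd : 0 < d) (hdn : d < n)
    (hD : simplicial_complex D) (hpure : pure_dim d D) :
  has_linear_resolution (determinantal_facet_ideal K d D) <->
  D = skeleton d (simplex n).
Proof.
split=> [|->]; first exact: linear_resolution_complete.
exact: skeleton_linear_resolution.
Qed.
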